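(* Let $n\ge 2$, let $(V,[,\ldots,],\alpha=(\alpha_1,\ldots,\alpha_{n-1}))$ be an $n$-ary Hom-Nambu algebra (respectively, an $n$-ary Hom-Nambu-Lie algebra), and let $\beta\colon V\to V$ be a weak morphism, i.e. a linear map with $\beta([x_1,\ldots,x_n])=[\beta(x_1),\ldots,\beta(x_n)]$ for all $x_i\in V$. Then $$V_\beta=(V,\ [,\ldots,]_\beta=\beta\circ[,\ldots,],\ \beta\alpha=(\beta\alpha_1,\ldots,\beta\alpha_{n-1}))$$ is also an $n$-ary Hom-Nambu algebra (respectively, an $n$-ary Hom-Nambu-Lie algebra). Moreover, if $V$ is multiplicative and $\beta\alpha=\alpha\beta$ (where $\alpha$ denotes the common twisting map), then $V_\beta$ is also multiplicative.
   Context: We work over a fixed field $\mathbf{k}$ of characteristic $0$. For an integer $n\ge 2$, an $n$-ary Hom-algebra $(V,[,\ldots,],\alpha=(\alpha_1,\ldots,\alpha_{n-1}))$ consists of a $\mathbf{k}$-module $V$, an $n$-linear map $[,\ldots,]\colon V^{\otimes n}\to V$, and linear maps $\alpha_i\colon V\to V$ ($1\le i\le n-1$), called twisting maps. It is multiplicative if $\alpha_1=\cdots=\alpha_{n-1}=\alpha$ and $\alpha\circ[,\ldots,]=[,\ldots,]\circ\alpha^{\otimes n}$. The product is anti-symmetric if $[x_1,\ldots,x_n]=\epsilon(\sigma)[x_{\sigma(1)},\ldots,x_{\sigma(n)}]$ for all $x_i\in V$ and all permutations $\sigma$ of $n$ letters, with $\epsilon(\sigma)$ the signature of $\sigma$.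 An $n$-ary Hom-Nambu algebra is an $n$-ary Hom-algebra satisfying the $n$-ary Hom-Nambu identity $$[\alpha_1(x_1),\ldots,\alpha_{n-1}(x_{n-1}),[y_1,\ldots,y_n]]=\sum_{i=1}^n[\alpha_1(y_1),\ldots,\alpha_{i-1}(y_{i-1}),[x_1,\ldots,x_{n-1},y_i],\alpha_i(y_{i+1}),\ldots,\alpha_{n-1}(y_n)]$$ for all $x_1,\ldots,x_{n-1},y_1,\ldots,y_n\in V$. An $n$-ary Hom-Nambu-Lie algebra is an $n$-ary Hom-Nambu algebra whose product is anti-symmetric. *)

(* Defs.v *)
From HB Require Import structures.
From mathcomp Require Import all_boot all_order all_fingroup all_algebra.

Set Implicit Arguments.
Unset Strict Implicit.
Unset Printing Implicit Defensive.

Import GRing.Theory.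
Local Open Scope ring_scope.

Section NaryHomAlgebra.

Variables (k : fieldType) (V : lmodType k) (n : nat).

(* Indices are 0-based: the n arguments of the product are indexed by 'I_n
   and the n-1 twisting maps by 'I_n.-1. *)
Implicit Types (mu : {ffun 'I_n -> V} -> V).
Implicit Types (alpha : 'I_n.-1 -> {linear V -> V}) (beta : {linear V -> V}).

Definition replace_arg (x : {ffun 'I_n -> V}) (i : 'I_n) (v : V) :
    {ffun 'I_n -> V} :=
  [ffun j => if j == i then v else x j].

Definition nlinear mu : Prop :=
  forall (x : {ffun 'I_n -> V}) (i : 'I_n),
    linear (fun v => mu (replace_arg x i v)).

(* (a_1, ..., a_{n-1}, z) *)
Definition append_arg (a : 'I_n.-1 -> V) (z : V) : {ffun 'I_n -> V} :=
  [ffun j : 'I_n => if insub (val j) is Some l then a l else z].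

(* (a_1, ..., a_{i-1}, z, a_i, ..., a_{n-1}), with z in position i *)
Definition insert_arg (i : 'I_n) (a : 'I_n.-1 -> V) (z : V) :
    {ffun 'I_n -> V} :=
  [ffun j => if unlift i j is Some l then a l else z].

(* [lift i] enumerates in increasing order the positions other than i, so in
   the i-th summand alpha_l is applied to y_l for l < i and to y_{l+1} for
   l >= i. *)
Definition hom_nambu_identity mu alpha : Prop :=
  forall (x : {ffun 'I_n.-1 -> V}) (y : {ffun 'I_n -> V}),
    mu (append_arg (fun l => alpha l (x l)) (mu y)) =
    \sum_(i < n) mu (insert_arg i (fun l => alpha l (y (lift i l)))
                                  (mu (append_arg x (y i)))).

Definition antisymmetric_product mu : Prop :=
  forall (s : 'S_n) (x : {ffun 'I_n -> V}),
    mu x = (-1) ^+ s *: mu [ffun i => x (s i)].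

Definition weak_morphism mu beta : Prop :=
  forall x : {ffun 'I_n -> V}, beta (mu x) = mu [ffun i => beta (x i)].

Definition hom_nambu_algebra mu alpha : Prop :=
  nlinear mu /\ hom_nambu_identity mu alpha.

Definition hom_nambu_lie_algebra mu alpha : Prop :=
  hom_nambu_algebra mu alpha /\ antisymmetric_product mu.

Definition hom_multiplicative mu alpha : Prop :=
  (forall i j, alpha i =1 alpha j) /\
  (forall i, weak_morphism mu (alpha i)).

Definition twisted_product beta mu : {ffun 'I_n -> V} -> V := beta \o mu.

Definition twisted_maps beta alpha : 'I_n.-1 -> {linear V -> V} :=
  fun i => beta \o alpha i.

End NaryHomAlgebra.

(* Main.v *)
(* Since beta is a morphism, it can be pulled out of any bracket all of whose
   entries lie in its image; hence both sides of each identity for V_beta are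
   images, under beta or beta^2, of the corresponding sides for V. *)

Require Import Defs.
From mathcomp Require Import all_boot all_order all_fingroup all_algebra.

Set Implicit Arguments.
Unset Strict Implicit.
Unset Printing Implicit Defensive.

Import GRing.Theory.

Section Twist.

Local Open Scope ring_scope.

Variables (k : fieldType) (V : lmodType k) (n : nat).
Variables (mu : {ffun 'I_n -> V} -> V) (alpha : 'I_n.-1 -> {linear V -> V}).
Variable beta : {linear V -> V}.

(** Applying [beta_morph] to a bracket leaves an entrywise image under [beta]; this restores the
    [append_arg] shape in which the Hom-Nambu identity is written. *)
Lemma map_append_arg (a : 'I_n.-1 -> V) (z : V) :
  [ffun j => beta (append_arg a z j)] = append_arg (beta \o a) (beta z).
Proof. by apply/ffunP=> j; rewrite !ffunE; case: insub. Qed.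

Lemma map_insert_arg (i : 'I_n) (a : 'I_n.-1 -> V) (z : V) :
  [ffun j => beta (insert_arg i a z j)] = insert_arg i (beta \o a) (beta z).
Proof. by apply/ffunP=> j; rewrite !ffunE; case: unlift. Qed.

Lemma nlinear_twist : nlinear mu -> nlinear (twisted_product beta mu).
Proof.
by move=> mu_lin x i c u v; rewrite /twisted_product /= mu_lin linearP.
Qed.

Lemma antisymmetric_twist :
  antisymmetric_product mu -> antisymmetric_product (twisted_product beta mu).
Proof.
by move=> mu_anti s x; rewrite /twisted_product /= (mu_anti s) linearZ.
Qed.

Hypothesis beta_morph : weak_morphism mu beta.

Lemma hom_nambu_identity_twist :
  hom_nambu_identity mu alpha ->
  hom_nambu_identity (twisted_product beta mu) (twisted_maps beta alpha).
Proof.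
move=> mu_nambu x y; rewrite /twisted_product /=.
(* The first [n.-1] entries carry [beta] from the twisted maps, the last one from the inner twisted
   product, so one [beta] leaves the outer bracket. *)
have -> : mu (append_arg (fun l => twisted_maps beta alpha l (x l))
                         (beta (mu y))) =
          beta (mu (append_arg (fun l => alpha l (x l)) (mu y))).
  by rewrite (beta_morph (append_arg _ _)) map_append_arg.
(* The extracted [beta] and that of the outer product both pass through the sum; the summands are
   then compared one by one, pushing the inner [beta] back into the bracket. *)
rewrite mu_nambu !linear_sum; apply: eq_bigr => i _ /=.
by rewrite (beta_morph (insert_arg _ _ _)) map_insert_arg.
Qed.

Lemma hom_nambu_algebra_twist :
  hom_nambu_algebra mu alpha ->
  hom_nambu_algebra (twisted_product beta mu) (twisted_maps beta alpha).
Proof.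
by case=> /nlinear_twist ? /hom_nambu_identity_twist.
Qed.

Lemma hom_multiplicative_twist :
  (forall i, beta \o alpha i =1 alpha i \o beta) ->
  hom_multiplicative mu alpha ->
  hom_multiplicative (twisted_product beta mu) (twisted_maps beta alpha).
Proof.
move=> comm [alpha_eq alpha_morph]; split=> [i j v | i x] /=.
  by rewrite (alpha_eq i j).
(* The inner [beta], then [alpha i], move into the bracket, while the outer [beta] stays in front on
   both sides. *)
rewrite /twisted_product /= beta_morph alpha_morph; congr (beta (mu _)).
(* The entries are [alpha i (beta (x j))] against [beta (alpha i (x j))], which is where commutation
   enters. *)
by apply/ffunP=> j; rewrite !ffunE -[LHS]comm.
Qed.

End Twist.

Theorem theorem2p5 (k : fieldType) (char_k : [pchar k]%R =i pred0)
    (V : lmodType k) (n : nat) (n_ge2 : 2 <= n)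
    (mu : {ffun 'I_n -> V} -> V) (alpha : 'I_n.-1 -> {linear V -> V})
    (beta : {linear V -> V}) (beta_morph : weak_morphism mu beta) :
  [/\ hom_nambu_algebra mu alpha ->
        hom_nambu_algebra (twisted_product beta mu) (twisted_maps beta alpha),
      hom_nambu_lie_algebra mu alpha ->
        hom_nambu_lie_algebra (twisted_product beta mu)
                              (twisted_maps beta alpha)
    & hom_nambu_algebra mu alpha ->
        hom_multiplicative mu alpha ->
        (forall i, beta \o alpha i =1 alpha i \o beta) ->
        hom_multiplicative (twisted_product beta mu) (twisted_maps beta alpha)].
Proof.
split.
- exact: hom_nambu_algebra_twist.
- case=> nambu /antisymmetric_twist anti.
  by split; [exact: hom_nambu_algebra_twist | exact: anti].
- by move=> _ mult comm; exact: hom_multiplicative_twist.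
Qed.
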